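(* Let $\mathbb{I}=\mathbb{N}^*$ or $\mathbb{I}=\mathbb{Z}$ and let $z\in\{-1,0,1\}^{\mathbb{I}}$. If $z$ satisfies condition (Ch), then $z$ satisfies condition (S).
   Context: $\mathbb{N}^*=\{1,2,3,\dots\}$; sums $\sum_{n\le N}$ are over $1\le n\le N$. Condition (Ch) for $z$: for each choice of integers $1\le a_1<\dots<a_r$, $r\ge 0$, and exponents $i_0,i_1,\dots,i_r\in\{1,2\}$ not all equal to $2$, $$\frac1N\sum_{n\le N} z(n)^{i_0}\, z(n+a_1)^{i_1}\cdots z(n+a_r)^{i_r}\to 0\quad (N\to\infty).$$ Completely deterministic points: let $T$ be a homeomorphism of a compact metric space $X$ and $x\in X$. The point $x$ is completely deterministic if for every accumulation point $\nu$, in the weak topology on Borel probability measures (convergence of integrals of continuous functions), of the sequence $\left(\frac1N\sum_{n\le N}\delta_{T^nx}\right)_{N\ge1}$, the measure-theoretic (Kolmogorov–Sinai) entropy $h(T,\nu)$ is $0$. Condition (S) for $z$: for each homeomorphism $T$ of a compact metric space $X$, each continuous function $f$ on $X$ and each completely deterministic point $x\in X$, $$\frac1N\sum_{n\le N} f(T^nx)z(n)\to 0\quad (N\to\infty).$$ *)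

(* Defs.v *)
From HB Require Import structures.
From mathcomp Require Import all_boot all_order all_algebra complex.
From mathcomp Require Import all_classical all_reals all_analysis.
Set Implicit Arguments.
Unset Strict Implicit.
Unset Printing Implicit Defensive.
Import Order.TTheory GRing.Theory Num.Theory.
Import numFieldNormedType.Exports.
Local Open Scope classical_set_scope.
Local Open Scope ring_scope.

(* [g_sigma_algebraType], hence any Borel sigma-algebra, needs a pointed
   carrier; every space below contains a given point, so this excludes only
   the empty space. *)
#[short(type="pmetricType")]
HB.structure Definition PointedMetric (K : numDomainType) :=
  {M of Pointed M & Metric K M}.

Definition borel {R : realType} (X : pmetricType R) :=
  g_sigma_algebraType (@open X).

(* Every realType [R] is a model of the reals, so this is the field of
   complex numbers; naming it as a numClosedFieldType equips it with the
   topology of its norm. *)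
Definition Cplx (R : realType) : numClosedFieldType := R[i].

Section dynamics.
Context {R : realType} {X : pmetricType R}.

Definition homeomorphism (T : X -> X) : Prop :=
  continuous T /\
  exists S : X -> X, [/\ continuous S, cancel T S & cancel S T].

Definition borel_prob : Type := probability (borel X) R.

HB.instance Definition _ := gen_eqMixin borel_prob.
HB.instance Definition _ := gen_choiceMixin borel_prob.

Definition integral_against (mu : borel_prob) :
    {ptws continuousType X R -> R} :=
  fun f => (\int[mu]_x f x)%R.

(* The coarsest topology making [mu |-> \int f dmu] continuous for each
   continuous [f]. *)
Definition weak_prob : Type := initial_topology integral_against.
HB.instance Definition _ := Topological.on weak_prob.

Definition empirical_measure (T : X -> X) (x : X) (N : nat) :
    set (borel X) -> \bar R :=
  mscale (N.+1%:R^-1)%:nng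
    (msum (fun n => @dirac _ (borel X) (iter n.+1 T x) R) N.+1).

Section empirical.
Variables (T : X -> X) (x : X) (N : nat).

HB.instance Definition _ := Measure.on (empirical_measure T x N).

Let empirical_setT : empirical_measure T x N setT = 1%E.
Proof.
rewrite /empirical_measure /mscale /= /msum.
rewrite (eq_bigr (fun=> 1%:E)) => [|k _]; last exact: diracT.
have -> : (\sum_(k < N.+1) 1%:E)%E = N.+1%:R%:E :> \bar R.
  elim: N.+1 => [|m IH]; first by rewrite big_ord0.
  by rewrite big_ord_recr /= IH -EFinD -natr1.
by rewrite -EFinM mulVf// pnatr_eq0.
Qed.

HB.instance Definition _ :=
  Measure_isProbability.Build _ _ _ (empirical_measure T x N) empirical_setT.
End empirical.

(* [empirical T x N] is the N.+1-st term, so that the averages start at 1. *)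
Definition empirical (T : X -> X) (x : X) (N : nat) : weak_prob :=
  (empirical_measure T x N : probability (borel X) R).

(* [ln 0 = 0] in the library, so [0 * ln 0 = 0]. *)
Definition shannon (I : finType) (p : I -> R) : R :=
  - \sum_(i : I) p i * ln (p i).

Definition measurable_partition k (P : 'I_k -> set (borel X)) : Prop :=
  partition [set: 'I_k] P setT /\ forall i, measurable (P i).

(* The atoms of the join of T^-i P, 0 <= i < n, are indexed by their names;
   a name whose atom is empty contributes nothing to the entropy. *)
Definition join_atom (T : X -> X) k (P : 'I_k -> set (borel X)) n
    (w : {ffun 'I_n -> 'I_k}) : set (borel X) :=
  \bigcap_(i in [set: 'I_n]) (iter i T @^-1` P (w i)).

Definition join_entropy (T : X -> X) (nu : borel_prob)
    k (P : 'I_k -> set (borel X)) (n : nat) : R :=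
  shannon (fun w : {ffun 'I_n -> 'I_k} => fine (nu (join_atom T P w))).

(* Only used for accumulation points of empirical measures; these are
   T-invariant, so the limit exists by subadditivity. *)
Definition partition_entropy (T : X -> X) (nu : borel_prob)
    k (P : 'I_k -> set (borel X)) : \bar R :=
  limn (fun n => (join_entropy T nu P n / n%:R)%:E).

Definition ks_entropy (T : X -> X) (nu : borel_prob) : \bar R :=
  ereal_sup [set h | exists k (P : 'I_k -> set (borel X)),
                       measurable_partition P /\ h = partition_entropy T nu P].

Definition completely_deterministic (T : X -> X) (x : X) : Prop :=
  forall nu : weak_prob, cluster (empirical T x @ \oo) nu ->
    ks_entropy T nu = 0%E.

End dynamics.

Section conditions.
Context (R : realType) {I : Type}.
(* [idx n] is the element [n] of the index set [I], used for [n >= 1] only. *)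
Variables (idx : nat -> I) (z : I -> int).

Definition ternary : Prop := forall j, z j \in [:: -1; 0; 1].

(* [i ord0] is the exponent at [n], [i (lift ord0 s)] the one at [n + a s]. *)
Definition condition_Ch : Prop :=
  forall (r : nat) (a : 'I_r -> nat) (i : 'I_r.+1 -> nat),
    (forall s, 1 <= a s)%N ->
    (forall s t : 'I_r, s < t -> a s < a t)%N ->
    (forall s, i s \in [:: 1; 2]%N) ->
    ~ (forall s, i s = 2%N) ->
    (fun N : nat =>
       (\sum_(1 <= n < N.+1)
          z (idx n) ^+ i ord0 *
          \prod_(s < r) z (idx (n + a s)%N) ^+ i (lift ord0 s))%:~R
       / N%:R : R) @ \oo --> (0 : R).

Definition condition_S : Prop :=
  forall (X : pmetricType R) (T : X -> X) (f : X -> Cplx R) (x : X),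
    compact [set: X] -> homeomorphism T -> continuous f ->
    completely_deterministic T x ->
    (fun N : nat =>
       (\sum_(1 <= n < N.+1) f (iter n T x) * (z (idx n))%:~R) / N%:R
       : Cplx R) @ \oo --> (0 : Cplx R).

End conditions.

Definition Npos : Type := {n : nat | (0 < n)%N}.
(* [n.-1.+1] is [n] for [n >= 1], the only arguments used. *)
Definition Npos_idx (n : nat) : Npos := exist _ n.-1.+1 (ltn0Sn n.-1).

(* Main.v *)
(* It suffices to show that the limit of the Cesaro means of f(T^n x) z(n) along
   any free ultrafilter U vanishes. Write E for the (shift-invariant) Cesaro mean
   along U.

   Entropy side: A |-> E(1_A(T^n x)) is a finitely additive probability on X. On
   the sets that are Jordan measurable for it, compactness makes it
   sigma-additive, so Caratheodory's extension produces a Borel probability nu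
   that agrees with it there; nu is a limit of the empirical measures, hence has
   entropy 0. All but countably many sets {f < c} are Jordan measurable, so f is
   uniformly approximated by a function of a finite Jordan partition. As that partition has
   entropy 0, for m large all but a proportion eps of the n have their word of
   length m in a set of at most exp(gamma m) words.

   Chowla side: the vanishing of the correlations with all exponents equal to 1
   gives E(prod_h (1 + c_h z(n+h))) = 1 for all real c, and since
   1 + t >= exp(t - 2t^2) for t >= -1/2, a Chernoff bound follows:
   |sum_h c_h z(n+h)| >= delta m has density at most 2 exp(- kappa m). The union
   bound over the exp(gamma m) words, with gamma < kappa, concludes. *)
From HB Require Import structures.
Require Import Defs.
From mathcomp Require Import all_boot all_order all_algebra complex.
From mathcomp Require Import all_classical all_reals all_analysis.
From mathcomp Require Import measurable_realfun zify ring lra.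
Set Implicit Arguments.
Unset Strict Implicit.
Unset Printing Implicit Defensive.
Import Order.TTheory GRing.Theory Num.Theory.
Import numFieldNormedType.Exports.
Local Open Scope classical_set_scope.
Local Open Scope ring_scope.

(** * Cesaro means along an ultrafilter *)

Section cesaro_mean.
Context {R : realType}.
Implicit Types g h : nat -> R.

Definition bounded_seq g := exists C, forall n, `|g n| <= C.

(** Term [N] averages over 1, ..., N+1, in step with [empirical]; the value [g 0] never enters. *)
Definition cesaro g (N : nat) : R := (\sum_(n < N.+1) g n.+1) / N.+1%:R.

Lemma bounded_seq_cst (c : R) : bounded_seq (fun=> c).
Proof. by exists `|c|. Qed.

Lemma bounded_seqD g h :
  bounded_seq g -> bounded_seq h -> bounded_seq (fun n => g n + h n).
Proof.
move=> [C gC] [D hD]; exists (C + D) => n.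
by rewrite (le_trans (ler_normD _ _))// lerD.
Qed.

Lemma bounded_seqM g h :
  bounded_seq g -> bounded_seq h -> bounded_seq (fun n => g n * h n).
Proof.
move=> [C gC] [D hD]; exists (C * D) => n.
by rewrite normrM ler_pM.
Qed.

Lemma bounded_seqZ (c : R) g : bounded_seq g -> bounded_seq (fun n => c * g n).
Proof. exact/bounded_seqM/bounded_seq_cst. Qed.

Lemma bounded_seq_norm g : bounded_seq g -> bounded_seq (fun n => `|g n|).
Proof. by move=> [C gC]; exists C => n; rewrite normr_id. Qed.

Lemma bounded_seq_shift g k : bounded_seq g -> bounded_seq (fun n => g (n + k)%N).
Proof. by move=> [C gC]; exists C => n. Qed.

Lemma bounded_seq_sum (J : Type) (s : seq J) (P : pred J) (G : J -> nat -> R) :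
  (forall j, bounded_seq (G j)) -> bounded_seq (fun n => \sum_(j <- s | P j) G j n).
Proof.
move=> bG; elim: s => [|j s IH].
  by under eq_fun do rewrite big_nil; exact: bounded_seq_cst.
under eq_fun do rewrite big_cons.
by case: (P j) => //; apply: bounded_seqD.
Qed.

Lemma bounded_seq_prod (J : Type) (s : seq J) (P : pred J) (G : J -> nat -> R) :
  (forall j, bounded_seq (G j)) -> bounded_seq (fun n => \prod_(j <- s | P j) G j n).
Proof.
move=> bG; elim: s => [|j s IH].
  by under eq_fun do rewrite big_nil; exact: bounded_seq_cst.
under eq_fun do rewrite big_cons.
by case: (P j) => //; apply: bounded_seqM.
Qed.

Lemma le_cesaro g h N : (forall n, g n <= h n) -> cesaro g N <= cesaro h N.
Proof.
by move=> gh; rewrite ler_pM2r ?invr_gt0// ler_sum.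
Qed.

Lemma cesaro_cst (c : R) N : cesaro (fun=> c) N = c.
Proof.
by rewrite /cesaro sumr_const card_ord -[c *+ _]mulr_natr mulfK// pnatr_eq0.
Qed.

Lemma cesaroD g h N : cesaro (fun n => g n + h n) N = cesaro g N + cesaro h N.
Proof. by rewrite /cesaro big_split mulrDl. Qed.

Lemma cesaroZ c g N : cesaro (fun n => c * g n) N = c * cesaro g N.
Proof. by rewrite /cesaro -mulr_sumr mulrA. Qed.

Lemma cesaro_norm_le g (C : R) N : (forall n, `|g n| <= C) -> `|cesaro g N| <= C.
Proof.
move=> gC; rewrite -(cesaro_cst C N) ler_norml -[- cesaro _ _]mulN1r -cesaroZ.
by apply/andP; split; apply: le_cesaro => n; have := gC n;
  rewrite ler_norml => /andP[]; rewrite ?mulN1r.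
Qed.

Lemma cesaro_shift g (C : R) N : (forall n, `|g n| <= C) ->
  `|cesaro (fun n => g n.+1) N - cesaro g N| <= (C + C) / N.+1%:R.
Proof.
move=> gC; rewrite /cesaro -mulrBl normrM [X in _ * X]ger0_norm ?invr_ge0//.
rewrite ler_pM2r ?invr_gt0//.
rewrite [X in X - _]big_ord_recr/= [X in _ - X]big_ord_recl/=.
rewrite [X in _ - (_ + X)](eq_bigr (fun i : 'I_N => g i.+2))//.
rewrite (_ : _ - _ = g N.+2 - g 1%N); last by rewrite /=; ring.
by rewrite (le_trans (ler_normB _ _))// lerD.
Qed.

Variable U : set_system nat.
Hypothesis U_ultra : UltraFilter U.
Hypothesis U_oo : \oo `<=` U.

Definition mean g : R := lim (cesaro g @ U).

(** The averages stay in a compact segment, so their image ultrafilter has a cluster point, and an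
    ultrafilter converges to each of its cluster points. *)
Lemma cvg_mean g : bounded_seq g -> cesaro g @ U --> mean g.
Proof.
move=> [C gC].
have UC : (cesaro g @ U) `[- C, C]%classic.
  have -> // : (cesaro g @ U) `[- C, C]%classic = U setT; last exact: filterT.
  rewrite /fmap/=; congr U; apply/seteqP; split=> // N _ /=.
  by rewrite in_itv/= -ler_norml cesaro_norm_le.
have [p [_ clp]] := @segment_compact R (- C) C _ _ UC.
suff cp : cesaro g @ U --> p by rewrite /mean (cvg_lim _ cp).
move=> V Vp; have [//|UV] := in_ultra_setVsetC (cesaro g @^-1` V) U_ultra.
have [q [nVq Vq]] := clp (~` V) V UV Vp.
by case: nVq.
Qed.

Lemma meanE g l : cesaro g @ U --> l -> mean g = l.
Proof. by move=> gl; rewrite /mean (cvg_lim _ gl). Qed.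

Lemma mean_cst (c : R) : mean (fun=> c) = c.
Proof.
apply: meanE; rewrite (_ : cesaro _ = cst c); first exact: cvg_cst.
by apply/funext => N; rewrite cesaro_cst.
Qed.

Lemma meanD g h : bounded_seq g -> bounded_seq h ->
  mean (fun n => g n + h n) = mean g + mean h.
Proof.
move=> bg bh; apply: meanE; rewrite (funext (cesaroD g h)).
exact: cvgD (cvg_mean bg) (cvg_mean bh).
Qed.

Lemma meanZ c g : bounded_seq g -> mean (fun n => c * g n) = c * mean g.
Proof.
move=> bg; apply: meanE; rewrite (funext (cesaroZ c g)).
exact: cvgMr (cvg_mean bg).
Qed.

Lemma mean_sum (J : Type) (s : seq J) (P : pred J) (G : J -> nat -> R) :
  (forall j, bounded_seq (G j)) ->
  mean (fun n => \sum_(j <- s | P j) G j n) = \sum_(j <- s | P j) mean (G j).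
Proof.
move=> bG; elim: s => [|j s IH].
  by under eq_fun do rewrite big_nil; rewrite big_nil mean_cst.
under eq_fun do rewrite big_cons.
rewrite big_cons; case: (P j) => //; rewrite meanD ?IH//.
exact: bounded_seq_sum.
Qed.

Lemma le_mean g h : bounded_seq g -> bounded_seq h ->
  (forall n, g n <= h n) -> mean g <= mean h.
Proof.
move=> bg bh gh; apply: ler_lim.
- by apply/cvg_ex; exists (mean g); exact: cvg_mean.
- by apply/cvg_ex; exists (mean h); exact: cvg_mean.
- by apply: nearW => N; exact: le_cesaro.
Qed.

Lemma mean_norm_le g : bounded_seq g -> `|mean g| <= mean (fun n => `|g n|).
Proof.
move=> bg; have bng := bounded_seq_norm bg; rewrite ler_norml; apply/andP; split.
  rewrite -mulN1r -meanZ//; apply: le_mean => //; first exact: bounded_seqZ.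
  by move=> n; rewrite mulN1r lerNl -normrN ler_norm.
by apply: le_mean => // n; exact: ler_norm.
Qed.

(** By telescoping the two averages differ by O(1/N), which tends to 0 along [U] because [U] refines
    [\oo]. *)
Lemma mean_shift1 g : bounded_seq g -> mean (fun n => g n.+1) = mean g.
Proof.
move=> bg; have [C gC] := bg; apply: meanE.
rewrite (_ : cesaro (fun n => g n.+1) =
  (fun N => cesaro (fun n => g n.+1) N - cesaro g N) \+ cesaro g); last first.
  by apply/funext => N /=; rewrite subrK.
rewrite -[X in _ --> X]add0r; apply: cvgD (cvg_mean bg).
suff : cesaro (fun n => g n.+1) N - cesaro g N @[N --> \oo] --> 0.
  by apply: cvg_trans => V; apply: U_oo.
apply/cvgr0Pnorm_le => e e0; have C0 : 0 <= C by exact: le_trans (gC 0%N).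
have ce0 : 0 < (C + C + 1) / e by rewrite divr_gt0//; lra.
near=> N.
rewrite (le_trans (cesaro_shift _ gC))// ler_pdivrMr// mulrC -ler_pdivrMr//.
apply: (@le_trans _ _ ((C + C + 1) / e)); first by rewrite ler_pM2r ?invr_gt0//; lra.
near: N; exists (Num.truncn ((C + C + 1) / e)) => // N /= tN.
by rewrite (le_trans (ltW (truncnS_gt _)))// ler_nat ltnS.
Unshelve. all: by end_near. Qed.

Lemma mean_shift g k : bounded_seq g -> mean (fun n => g (n + k)%N) = mean g.
Proof.
move=> bg; elim: k => [|k IH].
  by congr mean; apply/funext => n; rewrite addn0.
rewrite -IH -[RHS]mean_shift1; last exact: bounded_seq_shift.
by congr mean; apply/funext => n; rewrite addnS.
Qed.

End cesaro_mean.

(** * From finitely additive to Borel probabilities *)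

(** Every subset gets a mass, as densities along an ultrafilter exist for all sets; countable
    additivity is recovered only on the algebra of Jordan sets. *)
Record finitely_additive_prob (R : realType) (X : Type) := FinitelyAdditiveProb {
  fap_fun :> set X -> R ;
  fap_ge0 : forall A, 0 <= fap_fun A ;
  fapT : fap_fun setT = 1 ;
  fapU : forall A B, A `&` B = set0 ->
    fap_fun (A `|` B) = fap_fun A + fap_fun B }.

Section finitely_additive_theory.
Context {R : realType} {X : Type} (m : finitely_additive_prob R X).
Implicit Types A B : set X.

Lemma fap0 : m set0 = 0.
Proof.
have /esym/eqP := fapU m (setI0 set0).
by rewrite setU0 -subr_eq0 addrK => /eqP.
Qed.

Lemma fapD A B : A `<=` B -> m B = m A + m (B `\` A).
Proof. by move=> AB; rewrite -fapU ?setDIK// setDUK. Qed.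

Lemma le_fap A B : A `<=` B -> m A <= m B.
Proof. by move=> /fapD ->; rewrite lerDl fap_ge0. Qed.

Lemma le_fapU A B : m (A `|` B) <= m A + m B.
Proof.
rewrite (@fapD A (A `|` B)); last exact: subsetUl.
by rewrite lerD2l; apply: le_fap => x [[//|Bx] nAx].
Qed.

Lemma le_fap_bigU (J : Type) (s : seq J) (F : J -> set X) :
  m (\big[setU/set0]_(j <- s) F j) <= \sum_(j <- s) m (F j).
Proof.
elim: s => [|j s IH]; first by rewrite !big_nil fap0.
by rewrite !big_cons (le_trans (le_fapU _ _))// lerD2l.
Qed.

Lemma fap_bigU (F : nat -> set X) n : trivIset setT F ->
  m (\big[setU/set0]_(i < n) F i) = \sum_(i < n) m (F i).
Proof.
move=> tF; elim: n => [|n IH]; first by rewrite !big_ord0 fap0.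
rewrite !big_ord_recr/= fapU ?IH// -bigcup_mkord; apply/seteqP; split=> x //=.
by case=> -[i /= ni Fix] Fnx; have /eqP := tF i n I I (ex_intro _ x (conj Fix Fnx));
  rewrite ltn_eqF.
Qed.

End finitely_additive_theory.

(** * Jordan measurable sets and the Caratheodory extension *)

Section jordan.
Context {R : realType} {X : pmetricType R} (m : finitely_additive_prob R X).
Implicit Types A B : set X.

(* [A] is squeezed between a closed and an open set up to arbitrarily small
   mass, the analogue of Jordan measurability. *)
Definition jordan A := forall e, 0 < e ->
  exists K G, [/\ closed K, open G, K `<=` A, A `<=` G & m (G `\` K) <= e].

Lemma jordan0 : jordan set0.
Proof.
move=> e e0; exists set0, set0; split=> //; [exact: closed0|exact: open0|].
by rewrite setD0 fap0 ltW.
Qed.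

Lemma jordanC : setC_closed jordan.
Proof.
move=> A jA e /jA [K [G [cK oG KA AG mGK]]]; exists (~` G), (~` K); split.
- exact: open_closedC.
- exact: closed_openC.
- exact: subsetC.
- exact: subsetC.
- by rewrite setDE setCK setIC -setDE.
Qed.

Lemma jordanU : setU_closed jordan.
Proof.
move=> A B jA jB e e0; have e20 : 0 < e / 2 by rewrite divr_gt0.
have [K [G [cK oG KA AG mGK]]] := jA _ e20.
have [L [H [cL oH LB BH mHL]]] := jB _ e20.
exists (K `|` L), (G `|` H); split.
- exact: closedU.
- exact: openU.
- exact: setUSS.
- exact: setUSS.
- rewrite (le_trans (le_fap m (_ : _ `<=` (G `\` K) `|` (H `\` L))))//.
    move=> x [GH nKL]; case: GH => ?; [left|right]; split=> // ?; apply: nKL.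
      by left.
    by right.
  by rewrite (le_trans (le_fapU _ _ _))// (splitr e) lerD.
Qed.

Lemma jordanI : setI_closed jordan.
Proof.
move=> A B jA jB; rewrite -(setCK (A `&` B)) setCI.
by apply: jordanC; apply: jordanU; apply: jordanC.
Qed.

Lemma jordanT : jordan setT.
Proof. by rewrite -setC0; apply/jordanC/jordan0. Qed.

Lemma jordan_preimage (T : X -> X) A : continuous T ->
  (forall B, m (T @^-1` B) = m B) -> jordan A -> jordan (T @^-1` A).
Proof.
move=> cT mT jA e /jA [K [G [cK oG KA AG mGK]]].
exists (T @^-1` K), (T @^-1` G); split.
- exact: (continuous_closedP T).1.
- exact: (continuousP T).1.
- exact: preimage_subset.
- exact: preimage_subset.
- by rewrite [X in m X](_ : _ = T @^-1` (G `\` K))// mT.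
Qed.

(* The vacuous [let] makes the algebra of sets below depend on [m]. *)
Definition jordan_space : Type := let _ := m in X.

HB.instance Definition _ := Pointed.copy jordan_space X.
HB.instance Definition _ := isAlgebraOfSets.Build default_measure_display
  jordan_space jordan0 jordanU jordanC.

Definition jordan_content (A : set jordan_space) : \bar R := (m A)%:E.

Let jordan_content_ge0 A : (0 <= jordan_content A)%E.
Proof. by rewrite lee_fin fap_ge0. Qed.

Let jordan_content_semi_additive :
  measure_function.semi_additive jordan_content.
Proof.
by move=> F n mF tF _; rewrite /jordan_content fap_bigU// sumEFin.
Qed.

HB.instance Definition _ := isContent.Build _ _ _ jordan_content
  jordan_content_ge0 jordan_content_semi_additive.

(* Compactness turns finite additivity into sigma-additivity: a closed set
   inside a countable union of open sets meets only finitely many of them. *)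
Lemma jordan_content_sigma_subadditive : compact [set: X] ->
  measurable_subset_sigma_subadditive jordan_content.
Proof.
move=> cX A F jF jA AF; rewrite /jordan_content.
(* Half of [e] pays for a closed set inside [A]; the other half is spread geometrically over open
   enlargements of the [F n]. *)
apply/lee_addgt0Pr => e e0; rewrite [e]splitr EFinD addeA.
have e20 : 0 < e / 2 by rewrite divr_gt0.
apply: le_trans (leeD2r _ (epsilon_trick _ _ (ltW e20))) => //=; last first.
  by move=> n; rewrite lee_fin fap_ge0.
have [K [G [cK oG KA AG mGK]]] := jA _ e20.
have /choice[H jH] : forall n, exists H : set X,
    [/\ open H, F n `<=` H & m H <= m (F n) + e / 2 / (2 ^ n.+1)%:R].
  move=> n; have en0 : 0 < e / 2 / (2 ^ n.+1)%:R.
    by rewrite divr_gt0// ltr0n expn_gt0.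
  have [L [H [_ oH LF FH mHL]]] := jF n _ en0; exists H; split=> //.
  rewrite (fapD m FH) lerD2l (le_trans _ mHL)//; apply: le_fap.
  exact: setDS.
have cK' : compact K by apply: subclosed_compact cX _.
have [D _ KD] : finite_subset_cover setT H K.
  have cvK : @cover_compact X K by rewrite -compact_cover.
  apply: cvK => [i _|x /KA/AF [i _ Fx]]; first by have [] := jH i.
  by exists i => //; have [_ FH _] := jH i; exact: FH.
have mK : m K <= \sum_(i <- finmap.enum_fset D) m (H i).
  rewrite (le_trans _ (le_fap_bigU _ _ _))//; apply: le_fap.
  by move=> x /KD; rewrite /cover bigcup_fset.
have mA : m A <= m K + e / 2.
  by rewrite (fapD m KA) lerD2l (le_trans _ mGK)//; apply: le_fap; exact: setSD.
(* All indices of the finite subcover lie below [N], so its sum is dominated by a partial sum of the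
   series. *)
pose N := (\max_(i <- finmap.enum_fset D) i).+1.
pose a n := m (F n) + e / 2 / (2 ^ n.+1)%:R.
have a0 n : 0 <= a n by rewrite addr_ge0 ?fap_ge0// divr_ge0// ltW.
have aN : \sum_(i <- finmap.enum_fset D) a i <= \sum_(0 <= n < N) a n.
  rewrite [leRHS](bigID (fun i => i \in finmap.enum_fset D))/= -[leLHS]addr0.
  rewrite lerD ?sumr_ge0//.
  rewrite -[leRHS]big_filter le_eqVlt; apply/orP; left; apply/eqP.
  apply: perm_big; apply: uniq_perm;
    rewrite ?finmap.fset_uniq ?filter_uniq ?iota_uniq// => i.
  rewrite mem_filter mem_index_iota/=; case iD : (i \in finmap.enum_fset D) => //=.
  by rewrite ltnS (leq_bigmax_seq i).
apply: (@le_trans _ _ (\sum_(0 <= n < N) (a n)%:E + (e / 2)%:E)%E).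
  rewrite sumEFin -EFinD lee_fin (le_trans mA)// lerD2r (le_trans mK)//.
  by rewrite (le_trans _ aN)// ler_sum// => i _; have [] := jH i.
by apply: leeD2r; apply: nneseries_lim_ge => n _ _; rewrite lee_fin a0.
Qed.

(** Caratheodory's extension lives on the sigma-algebra generated by the Jordan sets; the hypothesis
    on open sets makes this contain the Borel sets. *)
Lemma jordan_extension : compact [set: X] -> (forall O, open O ->
    exists F : nat -> set X, (forall n, jordan (F n)) /\ O = \bigcup_n F n) ->
  exists nu : borel_prob (X := X), forall A, jordan A -> nu A = (m A)%:E.
Proof.
move=> cX openF.
pose mu : {measure set jordan_space -> \bar R} := HB.pack jordan_content
  (Content_SigmaSubAdditive_isMeasure.Build _ R jordan_space jordan_content
    (jordan_content_sigma_subadditive cX)).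
pose Y := g_sigma_algebraType (@measurable _ jordan_space).
pose ext : {measure set Y -> \bar R} := measure_extension mu.
(* Pushing forward along the identity restricts the extension to the Borel sets. *)
pose i : Y -> borel X := id.
have mi : measurable_fun setT i.
  have := @measurability _ _ _ (borel X) setT i (@open X) (erefl _).
  apply=> _ [V oV <-].
  rewrite setTI; have [F [jF ->]] := openF V oV.
  rewrite preimage_bigcup; apply: bigcupT_measurable => n.
  by apply: sub_gen_smallest; exact: jF.
have [nu0 nu0E] : exists nu0 : {measure set (borel X) -> \bar R},
    forall A, nu0 A = ext A.
  by unshelve eexists (pushforward ext i); first exact: mi.
have extE A : jordan A -> nu0 A = (m A)%:E.
  by move=> jA; rewrite nu0E; exact: (measurable_mu_extE mu jA).
have nuT : nu0 setT = 1%E by rewrite extE ?fapT//; exact: jordanT.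
(* The mass is already 1: normalizing changes no value and only supplies the probability structure,
   with the Dirac measure as default for a degenerate mass. *)
exists (mnormalize nu0 (@dirac _ (borel X) point R)) => A jA.
by rewrite /= /mnormalize nuT onee_eq0/= invr1 mule1 extE.
Qed.

End jordan.

(** * Jordan sets from sublevel sets of continuous functions *)

Section jordan_thresholds.
Context {R : realType}.

(** A monotone function has countably many discontinuities, hence a Lebesgue-null set of them, which
    cannot fill the interval. *)
Lemma monotone_continuity_point (F : R -> R) (s t : R) : s < t ->
  {homo F : x y / x <= y} -> exists c, [/\ s < c, c < t &
    forall e, 0 < e -> exists a b, [/\ a < c, c < b & F b - F a <= e]].
Proof.
move=> st hF.
have [c [sc ct nD]] : exists c, [/\ s < c, c < t & ~ discontinuity F c].
  apply: contrapT => nc.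
  have := @discontinuity_countable R s t F (fun x y _ _ => @hF x y).
  move=> /countable_lebesgue_measure0.
  rewrite (_ : [set _ | _] = `]s, t[%classic); last first.
    apply/seteqP; split => c /=; first by case.
    move=> cst; split=> //; apply: contrapT => nD; apply: nc.
    by exists c; move: cst; rewrite in_itv/= => /andP[].
  rewrite lebesgue_measure_itv/= lte_fin st -EFinD => -[] /eqP.
  by rewrite subr_eq0 => /eqP ts; move: st; rewrite ts ltxx.
exists c; split=> // e e0.
have cl : cvg (F x @[x --> c^'-]).
  apply: nondecreasing_at_left_is_cvgr; first by apply: nearW => x a b _ _; exact: hF.
  near=> x; exists (F c) => _ [y /= yxc <-]; apply: hF.
  by move: yxc; rewrite in_itv/= => /andP[_ /ltW].
have cr : cvg (F x @[x --> c^'+]).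
  apply: nondecreasing_at_right_is_cvgr; first by apply: nearW => x a b _ _; exact: hF.
  near=> x; exists (F c) => _ [y /= yxc <-]; apply: hF.
  by move: yxc; rewrite in_itv/= => /andP[/ltW].
(* Both one-sided limits exist by monotonicity, so a failure of this equality would make [c] a
   discontinuity. *)
have lr : lim (F x @[x --> c^'-]) = lim (F x @[x --> c^'+]).
  by apply/eqP; apply: contrapT => /negP lr; apply: nD; split.
have e20 : 0 < e / 2 by rewrite divr_gt0.
near (c^'-) => a; near (c^'+) => b; exists a, b; split.
- by near: a; exact: nbhs_left_lt.
- by near: b; exact: nbhs_right_gt.
- have al : `|lim (F x @[x --> c^'-]) - F a| <= e / 2.
    by near: a; exact: cvgr_dist_le cl _ e20.
  have br : `|lim (F x @[x --> c^'+]) - F b| <= e / 2.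
    by near: b; exact: cvgr_dist_le cr _ e20.
  move: al br; rewrite lr !ler_norml; lra.
Unshelve. all: by end_near. Qed.

Context {X : pmetricType R} (m : finitely_additive_prob R X).

(** Let [c] be a continuity point of the monotone function sending c to the mass of {f < c}. For a <
    c < b close to [c], the gap between the closed {f <= a} and the open {f < c} lies in {f < b}
    minus {f < a}, which has small mass. *)
Lemma jordan_sublevel (f : X -> R) (s t : R) : continuous f -> s < t ->
  exists c, [/\ s < c, c < t & jordan m [set x | f x < c]].
Proof.
move=> cf st.
have [c [sc ct Fc]] := @monotone_continuity_point
  (fun c => m [set x | f x < c]) s t st (fun a b ab =>
    le_fap m (fun x fx => lt_le_trans fx ab)).
exists c; split=> // e /Fc [a [b [ac cb Fba]]].
exists [set x | f x <= a], [set x | f x < c]; split=> //.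
- exact: ((continuous_closedP f).1 cf [set y | y <= a] (@closed_le _ a)).
- exact: ((continuousP f).1 cf [set y | y < c] (@open_lt _ c)).
- by move=> x /= /le_lt_trans; apply.
- rewrite (le_trans _ Fba)//.
  rewrite (@fapD _ _ m [set x | f x < a] [set x | f x < b])/=; last first.
    by move=> x /= /lt_trans; apply; exact: lt_trans cb.
  rewrite [X in X - _]addrC addrK; apply: le_fap => x [/= fc /negP]; rewrite -ltNge => af.
  by split; [exact: lt_trans cb|apply/negP; rewrite -leNgt ltW].
Qed.

(** The points at distance at least [c n] from the complement exhaust [O] as the thresholds [c n]
    decrease to 0, and each can be chosen Jordan. *)
Lemma open_jordan_cover (O : set X) : open O ->
  exists F : nat -> set X, (forall n, jordan m (F n)) /\ O = \bigcup_n F n.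
Proof.
(* The distance to an empty complement is infinite, so that case is separate. *)
move=> oO; have [nO0|/set0P[a nOa]] := eqVneq (~` O) set0.
  exists (fun=> setT); split=> [_|]; first exact: jordanT.
  by rewrite bigcup_const// -(setCK O) nO0 setC0.
pose d x := edist_inf (~` O) x; pose g x := fine (d x).
have dfin x : d x \is a fin_num.
  rewrite ge0_fin_numE ?edist_inf_ge0//.
  apply: (@le_lt_trans _ _ (edist (x, a))); first by apply: ereal_inf_lbound; exists a.
  rewrite -ge0_fin_numE ?edist_ge0//; apply/edist_finP => /=.
  exists (mdist x a + 1); first by rewrite ltr_pwDr// mdist_ge0.
  by rewrite ballEmdist/= ltrDl.
have cg : continuous g.
  move=> x; apply: fine_cvg; rewrite fineK//; exact: edist_inf_continuous.
have gE x : O x <-> 0 < g x.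
  split=> [Ox|]; last first.
    by apply: contraPP => nOx; rewrite /g /d edist_inf0// ltxx.
  have /nbhs_ballP[e /= e0 xeO] : nbhs x O by exact: open_nbhs_nbhs.
  apply: (lt_le_trans e0); rewrite -lee_fin fineK//.
  apply: le_ereal_inf_tmp => _ [y nOy <-]; rewrite leNgt; apply/negP.
  by move=> /edist_lt_ball /xeO.
have /choice[c cP] : forall n : nat, exists c,
    [/\ n.+2%:R^-1 < c, c < n.+1%:R^-1 & jordan m [set x | g x < c]].
  by move=> n; apply: jordan_sublevel => //; rewrite ltf_pV2 ?posrE// ltr_nat.
exists (fun n => ~` [set x | g x < c n]); split=> [n|].
  by apply: jordanC; have [] := cP n.
apply/seteqP; split=> x.
  move=> /gE gx0; exists (Num.truncn (g x)^-1) => //=; apply/negP; rewrite -leNgt.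
  have [_ /ltW /le_trans + _] := cP (Num.truncn (g x)^-1); apply.
  by rewrite invf_ple ?posrE// ltW// truncnS_gt.
move=> [n _ /= /negP]; rewrite -leNgt => cg'; apply/gE; apply: lt_le_trans cg'.
by have [+ _ _] := cP n; apply: lt_trans; rewrite invr_gt0.
Qed.


End jordan_thresholds.

(** * Quantizing a continuous function by a finite Jordan partition *)

Section jordan_quantization.
Context {R : realType} {X : pmetricType R} (m : finitely_additive_prob R X).

(** A Jordan set need not be Borel, since any subset of an open set of mass 0 is Jordan, whereas the
    partitions in [ks_entropy] must be Borel. *)
Definition borel_jordan (A : set X) :=
  jordan m A /\ measurable (A : set (borel X)).

Lemma borel_jordanC A : borel_jordan A -> borel_jordan (~` A).
Proof. by move=> [jA mA]; split; [exact: jordanC|exact: measurableC]. Qed.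

Lemma borel_jordan_bigI (J : finType) (F : J -> set X) :
  (forall j, borel_jordan (F j)) -> borel_jordan (\bigcap_(j in [set: J]) F j).
Proof.
move=> jF; rewrite (_ : [set: J] = [set` enum J]); last first.
  by apply/seteqP; split=> j //= _; rewrite mem_enum.
rewrite bigcap_seq; apply: (big_ind borel_jordan) => // [|A B [jA mA] [jB mB]].
  by split; [exact: jordanT|exact: measurableT].
by split; [exact: jordanI|exact: measurableI].
Qed.

Lemma continuous_measurable_borel (T : X -> X) : continuous T ->
  measurable_fun setT (T : borel X -> borel X).
Proof.
move=> cT; have := @measurability _ _ (borel X) (borel X) setT T (@open X) (erefl _).
apply=> _ [V oV <-]; rewrite setTI; apply: sub_gen_smallest.
exact: (continuousP T).1.
Qed.

Lemma continuous_measurable_real (f : X -> R) : continuous f ->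
  measurable_fun setT (f : borel X -> R).
Proof.
move=> cf; have := @measurability _ _ (borel X) R setT f _ (RGenOpens.measurableE R).
apply=> _ [_ [a [b ->]] <-]; rewrite setTI; apply: sub_gen_smallest.
by apply: (continuousP f).1 => //; exact: interval_open.
Qed.

(** Each point is coded by its position relative to Jordan thresholds [t j], one in each interval of
    length eta/2 of a grid covering the range of [f]. *)
Lemma borel_jordan_quantization (f : X -> R) (C eta : R) :
  continuous f -> (forall x, `|f x| <= C) -> 0 < eta ->
  exists (k : nat) (q : X -> 'I_k), [/\ forall i, exists x, q x = i,
    forall i, borel_jordan (q @^-1` [set i]) &
    forall x y, q x = q y -> `|f x - f y| <= eta].
Proof.
move=> cf fC eta0.
have C0 : 0 <= C by exact: le_trans (fC point).
have eta20 : 0 < eta / 2 by rewrite divr_gt0.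
have /choice[t tP] : forall j : nat, exists c,
    [/\ - C - eta + j%:R * (eta / 2) < c, c < - C - eta + j.+1%:R * (eta / 2) &
     jordan m [set x | f x < c]].
  move=> j; apply: jordan_sublevel => //.
  by rewrite ltrD2l ltr_pM2r// ltr_nat.
(* Large enough for the separating index [j] below, since f x <= C. *)
pose N := (Num.truncn ((2 * C + eta) / (eta / 2))).+2.
pose w x := [ffun j : 'I_N => f x < t j].
(* If f y > f x + eta, the first grid point above f x is index [j], and f x < t j < f x + eta < f y:
   the codes differ at [j]. *)
have wf x y : w x = w y -> f y - f x <= eta.
  move=> wxy; rewrite leNgt; apply/negP => etaf.
  pose j := (Num.truncn ((f x + C + eta) / (eta / 2))).+1.
  have a0 : 0 <= f x + C + eta by have := fC x; rewrite ler_norml; lra.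
  have /andP[j1 j2] := truncn_itv (divr_ge0 a0 (ltW eta20)).
  have {}j2 : f x + C + eta < j%:R * (eta / 2) by rewrite -ltr_pdivrMr.
  have {}j1 : j%:R * (eta / 2) - eta / 2 <= f x + C + eta.
    by rewrite -[X in _ - X]mul1r -mulrBl /j -natr1 addrK -ler_pdivlMr.
  have jN : (j < N)%N.
    rewrite /j /N !ltnS; apply: Num.Theory.le_truncn.
    by rewrite ler_pM2r ?invr_gt0//; have := fC x; rewrite ler_norml; lra.
  have [t1 t2 _] := tP j.
  have : w x (Ordinal jN) = w y (Ordinal jN) by rewrite wxy.
  rewrite !ffunE/=.
  have -> : f x < t j by apply: lt_trans t1; move: j2; set b := _ * _; lra.
  suff -> : (f y < t j) = false by [].
  apply/negbTE; rewrite -leNgt; apply: le_trans (ltW t2) _.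
  by rewrite -natr1 mulrDl mul1r; move: j1; set b := _ * _; lra.
(* Only the codes that occur are kept, so that [q] is onto: the atoms of a [partition] must be
   nonempty. *)
pose V := [set v | `[< exists x, w x = v >]]%SET.
have wV x : w x \in V by rewrite inE; apply/asboolP; exists x.
exists #|V|, (fun x => enum_rank_in (wV point) (w x)); split.
- move=> i; have := enum_valP i; rewrite inE => /asboolP[x wx].
  by exists x; rewrite wx enum_valK_in.
- move=> i; rewrite (_ : _ @^-1` _ = \bigcap_(j in [set: 'I_N])
    (if enum_val i j then [set x | f x < t j] else ~` [set x | f x < t j])).
    apply: borel_jordan_bigI => j.
    suff jB : borel_jordan [set x | f x < t j].
      by case: ifP => // _; exact: borel_jordanC.
    split; first by have [] := tP j.
    apply: sub_gen_smallest.
    exact: ((continuousP f).1 cf [set y | y < t j] (@open_lt _ (t j))).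
  apply/seteqP; split => x /=.
    by move=> <- j _; rewrite enum_rankK_in// ffunE; case: ifP => // /negP.
  move=> xj; have -> : w x = enum_val i; last by rewrite enum_valK_in.
  apply/ffunP => j; rewrite ffunE; have := xj j I.
  by case: ifP => _ /= => [-> //|/negP/negbTE].
- move=> x y /(congr1 enum_val); rewrite !enum_rankK_in// => wxy.
  by rewrite ler_norml; have := wf _ _ wxy; have := wf _ _ (esym wxy); lra.
Qed.

End jordan_quantization.

(** * Limits of empirical measures *)

Section quantized_integral.
Context {R : realType} (d : measure_display) (T : measurableType d).
Variable mu : probability T R.

Lemma bounded_integrable_prob (f : T -> R) (C : R) :
  measurable_fun setT f -> (forall x, `|f x| <= C) ->
  mu.-integrable setT (EFin \o f).
Proof.
move=> mf fC; apply: measurable_bounded_integrable => //.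
  by rewrite (le_lt_trans (probability_le1 mu measurableT))// ltry.
by exists C; split; [exact: num_real|move=> M CM x _; apply: le_trans (fC x) (ltW CM)].
Qed.

Lemma Rintegral_sum_indic (J : Type) (s : seq J) (c : J -> R) (A : J -> set T) :
  (forall j, measurable (A j)) ->
  mu.-integrable setT (EFin \o (fun x => \sum_(j <- s) c j * \1_(A j) x)) /\
  (\int[mu]_x \sum_(j <- s) c j * \1_(A j) x)%R = \sum_(j <- s) c j * fine (mu (A j)).
Proof.
move=> mA; elim: s => [|j s [iI IH]].
  under [X in EFin \o X]eq_fun do rewrite big_nil.
  under eq_Rintegral do rewrite big_nil.
  rewrite big_nil Rintegral_cst// mul0r; split=> //.
  exact: finite_measure_integrable_cst.
have i1 : mu.-integrable setT (EFin \o \1_(A j)) by exact: integrable_indic.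
have ij : mu.-integrable setT (EFin \o (fun x => c j * \1_(A j) x)).
  by have := integrableZl measurableT (c j) i1.
split.
  have := integrableD measurableT ij iI.
  congr (_.-integrable _ _); apply/funext => x /=.
  by rewrite big_cons.
under eq_Rintegral do rewrite big_cons.
rewrite RintegralD// IH big_cons RintegralZl//.
by rewrite /Rintegral integral_indic// setIT.
Qed.

(** The approximating sum sees [mu] only through the masses of the atoms, so integrals against two
    measures can be compared atom by atom. *)
Lemma Rintegral_quantized k (q : T -> 'I_k) (f : T -> R) (c : 'I_k -> R) (C eta : R) :
  (forall i, measurable (q @^-1` [set i])) -> measurable_fun setT f ->
  (forall x, `|f x| <= C) -> (forall x, `|f x - c (q x)| <= eta) ->
  `|(\int[mu]_x f x)%R - \sum_(i < k) c i * fine (mu (q @^-1` [set i]))| <= eta.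
Proof.
move=> mq mf fC fc.
have [ig <-] := Rintegral_sum_indic (index_enum 'I_k) c mq.
have intf := bounded_integrable_prob mf fC.
have gE x : \sum_(i < k) c i * \1_(q @^-1` [set i]) x = c (q x).
  rewrite (bigD1 (q x))//= indicE mem_set// mulr1 big1 ?addr0// => i iq.
  rewrite indicE memNset ?mulr0// => /= qi.
  by move: iq; rewrite -qi eqxx.
rewrite -RintegralB//.
have id : mu.-integrable setT (EFin \o (fun x => f x -
    \sum_(i < k) c i * \1_(q @^-1` [set i]) x)).
  by have := integrableB measurableT intf ig.
rewrite (le_trans (le_normr_Rintegral measurableT id))//.
have -> : eta = (\int[mu]_(x in setT) eta)%R.
  rewrite Rintegral_cst// -[LHS]mulr1; congr (_ * _); rewrite -[LHS]/(fine 1%E).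
  by congr fine; exact/esym/probability_setT.
apply: le_Rintegral => //.
- exact: integrable_norm.
- exact: finite_measure_integrable_cst.
- by move=> x _; rewrite gE.
Qed.

End quantized_integral.

Lemma continuous_bounded (R : realType) (X : topologicalType) (f : X -> R) :
  compact [set: X] -> continuous f -> exists C, forall x, `|f x| <= C.
Proof.
move=> cX cf; have /compact_bounded[C [_ fC]] : compact (range f).
  by apply: continuous_compact cX; exact: continuous_subspaceT.
by exists (C + 1) => x; apply: fC; [rewrite ltrDl|exists x].
Qed.

Section empirical_limit.
Context {R : realType} {X : pmetricType R}.
Variables (T : X -> X) (x : X) (U : set_system nat).
Hypothesis cX : compact [set: X].
Hypotheses (U_ultra : UltraFilter U) (U_oo : \oo `<=` U).

Let orbit_fun (A : set X) : R := mean U (fun n => \1_A (iter n T x)).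

Let bounded_orbit (A : set X) : bounded_seq (fun n => \1_A (iter n T x) : R).
Proof.
by exists 1 => n; rewrite indicE; case: (_ \in A); rewrite ?normr1// normr0.
Qed.

Let orbit_ge0 A : 0 <= orbit_fun A.
Proof.
rewrite -(mean_cst U_ultra 0); apply: le_mean => //; exact: bounded_seq_cst.
Qed.

Let orbit_setT : orbit_fun setT = 1.
Proof.
rewrite -(mean_cst U_ultra 1); congr mean; apply/funext => n.
by rewrite indicE in_setT.
Qed.

Let orbit_setU A B : A `&` B = set0 ->
  orbit_fun (A `|` B) = orbit_fun A + orbit_fun B.
Proof.
move=> AB; rewrite -meanD//; congr mean; apply/funext => n.
rewrite !indicE in_setU; case: (boolP (_ \in A)) => [/set_mem Ax|_ /=];
  last by rewrite add0r.
rewrite memNset ?addr0// => Bx.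
by have : (A `&` B) (iter n T x) by []; rewrite AB.
Qed.

Definition orbit_density : finitely_additive_prob R X :=
  FinitelyAdditiveProb orbit_ge0 orbit_setT orbit_setU.

Lemma orbit_densityE A :
  orbit_density A = mean U (fun n => \1_A (iter n T x)).
Proof. by []. Qed.

Lemma orbit_density_preimage A : orbit_density (T @^-1` A) = orbit_density A.
Proof. by rewrite !orbit_densityE -[RHS]mean_shift1. Qed.

Lemma empirical_measureE (A : set (borel X)) N :
  empirical_measure T x N A = (cesaro (fun n => \1_A (iter n T x)) N)%:E.
Proof.
rewrite /empirical_measure /mscale /= /msum /cesaro mulrC EFinM; congr (_ * _)%E.
by rewrite -sumEFin; apply: eq_bigr.
Qed.

(** The measure is the extension of the orbit density. Weak convergence follows by quantizing each
    test function over Jordan atoms, whose empirical masses converge along [U]. *)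
Lemma exists_empirical_limit : exists nu : weak_prob (X := X),
  (forall A, jordan orbit_density A -> nu A = (orbit_density A)%:E) /\
  empirical T x @ U --> nu.
Proof.
have [nu nuE] := jordan_extension cX (@open_jordan_cover _ _ orbit_density).
exists nu; split=> //.
(* The weak topology is initial for a map into a product, so convergence is tested one integral at a
   time. *)
suff cvf (f : continuousType X R) :
    (fun N => integral_against (empirical_measure T x N : probability (borel X) R) f) @ U
    --> integral_against nu f.
  have ptw : {ptws, (integral_against \o empirical T x) @ U --> integral_against nu}.
    apply/cvg_sup => f V [_ [[W oW <-] /= Wf sWV]].
    have := cvf f W (open_nbhs_nbhs (conj oW Wf)).
    by move=> UW; apply: (@filterS _ U _ _ _ _ UW) => N; exact: sWV.
  move=> A /= [_ [[B oB <-] Bnu sBA]].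
  have := ptw B (open_nbhs_nbhs (conj oB Bnu)).
  by move=> UB; apply: (@filterS _ U _ _ _ _ UB) => N; exact: sBA.
have cf : continuous f by exact: cts_fun.
have [C fC] := continuous_bounded cX cf.
(* One third each for the quantization error under [nu], the one under the empirical measure, and
   the convergence of the atom masses. *)
apply/cvgrPdist_le => e e0; pose eta := e / 3.
have eta0 : 0 < eta by rewrite divr_gt0.
have [k [q [qs qj qf]]] := borel_jordan_quantization orbit_density cf fC eta0.
have /choice[y yq] := qs.
pose c i := f (y i).
have fc z : `|f z - c (q z)| <= eta by apply: qf; rewrite yq.
have mq i : measurable (q @^-1` [set i] : set (borel X)) by have [] := qj i.
have I1 (mu : probability (borel X) R) := Rintegral_quantized mu mq
  (continuous_measurable_real cf) fC fc.
pose S (g : set X -> R) := \sum_(i < k) c i * g (q @^-1` [set i]).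
have cvS : (fun N => S (fun A => cesaro (fun n => \1_A (iter n T x)) N)) @ U
    --> S orbit_density.
  apply: cvg_big => [|i _]; first exact: add_continuous.
  by apply: cvgMr; exact: cvg_mean.
near=> N.
have SN : `|S orbit_density - S (fun A => cesaro (fun n => \1_A (iter n T x)) N)| <= eta.
  by near: N; exact: (cvgrPdist_le _ _).1 cvS _ eta0.
have := I1 (empirical_measure T x N : probability (borel X) R).
have := I1 nu.
rewrite [X in _ - X](_ : _ = S orbit_density); last first.
  by apply: eq_bigr => i _; rewrite nuE//; have [] := qj i.
rewrite [X in _ -> `|_ - X| <= _ -> _](_ : _ =
    S (fun A => cesaro (fun n => \1_A (iter n T x)) N)); last first.
  apply: eq_bigr => i _; congr (_ * _).
  have := congr1 fine (empirical_measureE (q @^-1` [set i]) N).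
  by [].
move: SN; rewrite /integral_against /eta !ler_norml; lra.
Unshelve. all: by end_near. Qed.


Lemma exists_empirical_cluster : exists nu : weak_prob (X := X),
  (forall A, jordan orbit_density A -> nu A = (orbit_density A)%:E) /\
  cluster (empirical T x @ \oo) nu.
Proof.
have [nu [nuE cvnu]] := exists_empirical_limit; exists nu; split=> // A B eA nB.
have UA : U (empirical T x @^-1` A) by exact: U_oo.
have UB : U (empirical T x @^-1` B) by exact: cvnu.
by have [N [AN BN]] := filter_ex (filterI UA UB); exists (empirical T x N).
Qed.

End empirical_limit.

(** * Entropy of the coding *)

Section shannon_entropy.
Context {R : realType}.

(* Gibbs' inequality against the product of the two marginals. *)
Lemma shannon_subadditive (W I J : finType) (l : W -> I) (r : W -> J)
    (p : W -> R) :
  (forall w w', l w = l w' -> r w = r w' -> w = w') ->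
  (forall w, 0 <= p w) -> \sum_w p w = 1 ->
  shannon p <= shannon (fun i => \sum_(w | l w == i) p w) +
               shannon (fun j => \sum_(w | r w == j) p w).
Proof.
move=> lr_inj p0 p1.
set pl := fun i => _; set pr := fun j => _.
have pl0 i : 0 <= pl i by exact: sumr_ge0.
have pr0 j : 0 <= pr j by exact: sumr_ge0.
have margE (K : finType) (s : W -> K) (g : K -> R) :
    \sum_j (\sum_(w | s w == j) p w) * g j = \sum_w p w * g (s w).
  rewrite [RHS](partition_big s predT)//=; apply: eq_bigr => j _.
  by rewrite mulr_suml; apply: eq_bigr => w /eqP ->.
rewrite /shannon -opprD lerN2 !margE -big_split/=.
rewrite -subr_le0 -sumrB.
(* Termwise, p ln(pl pr / p) <= pl pr - p, from ln x <= x - 1. *)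
apply: (@le_trans _ _ (\sum_w (pl (l w) * pr (r w) - p w))).
  apply: ler_sum => w _; rewrite -mulrDr -mulrBr.
  have [pw0|pw0] := eqVneq (p w) 0; first by rewrite pw0 mul0r subr0 mulr_ge0.
  have {pw0} pw0 : 0 < p w by rewrite lt0r pw0 p0.
  have plw : 0 < pl (l w).
    by rewrite (lt_le_trans pw0)// /pl (bigD1 w)//= lerDl sumr_ge0.
  have prw : 0 < pr (r w).
    by rewrite (lt_le_trans pw0)// /pr (bigD1 w)//= lerDl sumr_ge0.
  rewrite -lnM ?posrE// -ln_div ?posrE ?mulr_gt0//.
  have x0 : 0 < pl (l w) * pr (r w) / p w by rewrite divr_gt0// mulr_gt0.
  rewrite -[X in _ <= X - _](divfK (lt0r_neq0 pw0)); set x := _ / _ in x0 *.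
  rewrite -[X in _ <= _ - X]mul1r -mulrBl mulrC ler_wpM2r//.
  by have := @le_ln1Dx R (x - 1); rewrite (addrC 1) subrK; apply; lra.
rewrite sumrB p1 subr_le0.
have margT (K : finType) (s : W -> K) : \sum_j \sum_(w | s w == j) p w = 1.
  by rewrite -p1 [RHS](partition_big s predT).
(* Distinct [w] have distinct pairs (l w, r w), so the sum over [w] is part of the full product sum,
   which is 1. *)
apply: (@le_trans _ _ (\sum_i \sum_j pl i * pr j)); last first.
  by under eq_bigr do rewrite -mulr_sumr margT mulr1; rewrite margT.
rewrite pair_big/= (bigID (mem ((fun w => (l w, r w)) @: [set: W]%SET)))/=.
rewrite big_imset/=; last by move=> w w' _ _ [] /lr_inj; apply.
rewrite [X in _ <= X + _](eq_bigl xpredT) => [|w]; last by rewrite inE.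
by rewrite lerDl sumr_ge0// => ij _; rewrite mulr_ge0.
Qed.

(** The limit is the infimum of a n / n over n > 0; n = 0 is excluded because division by 0 gives
    0. *)
Lemma fekete (a : nat -> R) : (forall n, 0 <= a n) ->
  (forall i j, a (i + j)%N <= a i + a j) ->
  exists l, (fun n => a n / n%:R) @ \oo --> (l : R).
Proof.
move=> a0 aD; pose E := [set a n / n%:R | n in [set n | (0 < n)%N]].
have hE : has_inf E.
  split; first by exists (a 1%N / 1%:R); exists 1%N.
  by exists 0 => _ [n /= n0 <-]; rewrite divr_ge0.
exists (inf E); apply/cvgrPdist_le => e e0.
have [_ [m /= m0 <-] aml] := inf_adherent (divr_gt0 e0 (ltr0Sn R 1)) hE.
(* Euclidean division by [m] reduces a n to about n/m copies of a m, plus a remainder bounded by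
   [M]. *)
have aM i k : a (i * m + k)%N <= i%:R * a m + a k.
  elim: i => [|i IH]; first by rewrite mul0n mul0r add0r.
  rewrite mulSn -addnA (le_trans (aD _ _))// -natr1 mulrDl mul1r.
  by rewrite addrAC [leRHS]addrC lerD2l.
pose M := \sum_(k < m) a k.
have aM' n : a n <= n%:R * (a m / m%:R) + M.
  rewrite {1}(divn_eq n m) (le_trans (aM _ _))// lerD//.
    rewrite mulrCA mulrC ler_wpM2l// ler_pdivlMr ?ltr0n// -natrM ler_nat.
    exact: leq_trunc_div.
  have nm : (n %% m < m)%N by rewrite ltn_mod.
  by rewrite /M (bigD1 (Ordinal nm))//= lerDl sumr_ge0.
near=> n.
have n0 : (0 < n)%N by near: n; exists 1%N.
have nR : 0 < n%:R :> R by rewrite ltr0n.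
have ln : inf E <= a n / n%:R by apply: ge_inf; [case: hE|exists n].
have Mn : M / n%:R <= e / 2.
  rewrite ler_pdivrMr// mulrC -ler_pdivrMr ?divr_gt0//.
  near: n; exists (Num.truncn (M / (e / 2))).+1 => // n /= tn.
  by rewrite (le_trans (ltW (truncnS_gt _)))// ler_nat.
have : a n / n%:R <= a m / m%:R + M / n%:R.
  rewrite ler_pdivrMr// mulrDl divfK ?gt_eqF//.
  by rewrite [X in _ <= X + _]mulrC; exact: aM'.
by rewrite ler0_norm ?subr_le0// opprB; move: aml Mn; lra.
Unshelve. all: by end_near. Qed.

End shannon_entropy.

(** * Frequencies and entropy of words *)

Section words.
Context {R : realType} (U : set_system nat).
Hypotheses (U_ultra : UltraFilter U) (U_oo : \oo `<=` U).
Context {k : nat} (v : nat -> 'I_k).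

Definition word n t : {ffun 'I_n -> 'I_k} := [ffun i : 'I_n => v (i + t)%N].

Definition word_freq n (w : {ffun 'I_n -> 'I_k}) : R :=
  mean U (fun t => (word n t == w)%:R).

Definition word_entropy n : R := shannon (@word_freq n).

Lemma bounded_seq_bool (b : nat -> bool) : bounded_seq (fun t => (b t)%:R : R).
Proof. by exists 1 => t; case: (b t); rewrite ?normr1// normr0. Qed.
#[local] Hint Resolve bounded_seq_bool : core.

Lemma sum_word_freq n (P : pred {ffun 'I_n -> 'I_k}) :
  \sum_(w | P w) word_freq w = mean U (fun t => (P (word n t))%:R).
Proof.
rewrite -mean_sum//; congr mean; apply/funext => t.
have [Pt|nPt] := boolP (P (word n t)).
  rewrite (bigD1 (word n t))//= eqxx big1 ?addr0// => w /andP[_ /negbTE].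
  by rewrite eq_sym => ->.
by rewrite big1// => w Pw; case: eqP => // tw; move: nPt; rewrite tw Pw.
Qed.

Lemma word_freq_ge0 n (w : {ffun 'I_n -> 'I_k}) : 0 <= word_freq w.
Proof.
by rewrite -(mean_cst U_ultra 0); apply: le_mean => //; exact: bounded_seq_cst.
Qed.

Lemma sum_word_freq1 n : \sum_w @word_freq n w = 1.
Proof. by rewrite sum_word_freq mean_cst. Qed.

Lemma word_freq_le1 n (w : {ffun 'I_n -> 'I_k}) : word_freq w <= 1.
Proof.
rewrite -(sum_word_freq1 n) (bigD1 w)//= lerDl sumr_ge0// => w' _.
exact: word_freq_ge0.
Qed.

Lemma entropy_term_ge0 n (w : {ffun 'I_n -> 'I_k}) :
  0 <= - (word_freq w * ln (word_freq w)).
Proof.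
by rewrite -mulrN mulr_ge0 ?word_freq_ge0// oppr_ge0 ln_le0// word_freq_le1.
Qed.

Lemma word_entropy_ge0 n : 0 <= word_entropy n.
Proof.
rewrite /word_entropy /shannon -sumrN; apply: sumr_ge0 => w _.
exact: entropy_term_ge0.
Qed.

(** A word splits into prefix and suffix; shift invariance of the mean gives the suffix the law of a
    word of length [n]. *)
Lemma word_entropy_subadditive m n :
  word_entropy (m + n) <= word_entropy m + word_entropy n.
Proof.
pose l (w : {ffun 'I_(m + n) -> 'I_k}) :=
  [ffun i : 'I_m => w (lshift n i)] : {ffun 'I_m -> 'I_k}.
pose r (w : {ffun 'I_(m + n) -> 'I_k}) :=
  [ffun i : 'I_n => w (rshift m i)] : {ffun 'I_n -> 'I_k}.
have lr_inj w w' : l w = l w' -> r w = r w' -> w = w'.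
  move=> lw rw; apply/ffunP => i; case: (split_ordP i) => j ->.
    by have /ffunP/(_ j) := lw; rewrite !ffunE.
  by have /ffunP/(_ j) := rw; rewrite !ffunE.
have := shannon_subadditive lr_inj (@word_freq_ge0 (m + n)) (sum_word_freq1 _).
rewrite -[X in shannon X + _](_ : @word_freq m = _); last first.
  apply/funext => u; rewrite sum_word_freq; congr mean; apply/funext => t.
  by congr (_ == _)%:R; apply/ffunP => i; rewrite !ffunE.
rewrite -[X in _ + shannon X](_ : @word_freq n = _)//.
apply/funext => u; rewrite sum_word_freq /word_freq -[LHS](mean_shift _ _ m)//.
congr mean; apply/funext => t; congr (_ == _)%:R; apply/ffunP => i.
by rewrite !ffunE/=; congr v; lia.
Qed.

Lemma cvg_word_entropy :
  exists h, (fun n => word_entropy n / n%:R) @ \oo --> (h : R).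
Proof. exact: fekete word_entropy_ge0 word_entropy_subadditive. Qed.

(* By Markov's inequality applied to [- ln p], whose mean is the entropy. *)
Lemma typical_words (gamma eps : R) : 0 < gamma -> 0 < eps ->
  (fun n => word_entropy n / n%:R) @ \oo --> (0 : R) ->
  \forall n \near \oo, exists W : {set {ffun 'I_n -> 'I_k}},
    #|W|%:R <= expR (gamma * n%:R) /\
    mean U (fun t => (word n t \notin W)%:R) <= eps.
Proof.
move=> gamma0 eps0 /cvgr0Pnorm_le h0.
near=> n.
have n0 : (0 < n)%N by near: n; exists 1%N.
have nR : 0 < n%:R :> R by rewrite ltr0n.
have : `|word_entropy n / n%:R| <= eps * gamma.
  by near: n; apply: h0; rewrite mulr_gt0.
rewrite ger0_norm ?divr_ge0 ?word_entropy_ge0// ler_pdivrMr// => Hn.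
(* Frequencies sum to 1, so at most exp(gamma n) words have frequency at least exp(-gamma n). *)
exists [set w | expR (- (gamma * n%:R)) <= word_freq w]%SET; split.
  rewrite -[leRHS]invrK -expRN -[leRHS]mul1r ler_pdivlMr ?expR_gt0//.
  rewrite -[leRHS](sum_word_freq1 n).
  rewrite [leRHS](bigID (fun w => expR (- (gamma * n%:R)) <= word_freq w))/=.
  rewrite -[leLHS]addr0 lerD//; last by apply: sumr_ge0 => *; exact: word_freq_ge0.
  rewrite mulr_natl -sumr_const.
  rewrite [leLHS](eq_bigl (fun w => expR (- (gamma * n%:R)) <= word_freq w)).
    by apply: ler_sum => w.
  by move=> w; rewrite inE.
rewrite -(sum_word_freq (fun w => w \notin _)).
(* A word outside the set has -ln p >= gamma n if p > 0, so these words account for at least gamma n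
   times their total frequency in the entropy. *)
rewrite -(@ler_pM2r _ (gamma * n%:R)) ?mulr_gt0// [leRHS]mulrA (le_trans _ Hn)//.
rewrite mulr_suml /word_entropy /shannon -sumrN [leRHS](bigID (fun w =>
  w \notin [set w | expR (- (gamma * n%:R)) <= word_freq w]%SET))/=.
rewrite -[leLHS]addr0 lerD//; last by apply: sumr_ge0 => *; exact: entropy_term_ge0.
apply: ler_sum => w; rewrite inE -ltNge => wn.
have [->|w0] := eqVneq (word_freq w) 0; first by rewrite !mul0r oppr0.
have {}w0 : 0 < word_freq w by rewrite lt0r w0 word_freq_ge0.
rewrite -mulrN ler_wpM2l ?word_freq_ge0// lerNr -ler_expR lnK ?posrE//.
exact: ltW.
Unshelve. all: by end_near. Qed.

End words.

(** * Zero word entropy along a completely deterministic orbit *)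

Section deterministic_words.
Context {R : realType} {X : pmetricType R}.
Variables (T : X -> X) (x : X) (U : set_system nat).
Hypotheses (cX : compact [set: X]) (cT : continuous T).
Hypotheses (U_ultra : UltraFilter U) (U_oo : \oo `<=` U).
Hypothesis x_det : completely_deterministic T x.

Lemma borel_jordan_iter (A : set X) n :
  borel_jordan (orbit_density T x U_ultra) A ->
  borel_jordan (orbit_density T x U_ultra) (iter n T @^-1` A).
Proof.
elim: n A => [//|n IH] A [jA mA].
rewrite -[_ @^-1` _]/(iter n T @^-1` (T @^-1` A)); apply: IH; split.
  by apply: jordan_preimage => // B; exact: orbit_density_preimage.
by have := continuous_measurable_borel cT measurableT mA; rewrite setTI.
Qed.

(** The join atoms are Jordan, so [nu] gives them the word frequencies. Hence word entropies are
    join entropies of [nu], whose growth rate is at most the KS entropy, which is 0. *)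
Lemma word_entropy_deterministic k (q : X -> 'I_k) :
  (forall i, exists y, q y = i) ->
  (forall i, borel_jordan (orbit_density T x U_ultra) (q @^-1` [set i])) ->
  (fun n => word_entropy U (fun t => q (iter t T x)) n / n%:R : R) @ \oo --> (0 : R).
Proof.
move=> qs qj; pose v t := q (iter t T x).
have [nu [nuE clnu]] := exists_empirical_cluster T x cX U_ultra U_oo.
have ks0 := x_det clnu.
pose P i := q @^-1` [set i].
have atomE n (w : {ffun 'I_n -> 'I_k}) : nu (join_atom T P w) = (word_freq U v w)%:E.
  rewrite nuE.
    rewrite orbit_densityE; congr (mean _ _)%:E; apply/funext => t.
    rewrite indicE; congr (_%:R); congr nat_of_bool; apply/idP/eqP.
      move=> /set_mem tw; apply/ffunP => i; rewrite ffunE /v iterD.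
      exact: tw i I.
    by move=> <-; apply/mem_set => i _ /=; rewrite ffunE /v iterD.
  have [] // : borel_jordan (orbit_density T x U_ultra) (join_atom T P w).
  by apply: borel_jordan_bigI => i; apply: borel_jordan_iter; exact: qj.
have [h hP] := @cvg_word_entropy R U U_ultra U_oo k v.
have h0 : 0 <= h.
  rewrite -(cvg_lim _ hP)//; apply: limr_ge; first by apply/cvg_ex; exists h.
  by apply: nearW => n; rewrite divr_ge0// word_entropy_ge0.
have hE : partition_entropy T nu P = h%:E.
  apply/cvg_lim => //; apply: cvg_EFin; first exact: nearW.
  rewrite (_ : _ \o _ = (fun n => word_entropy U v n / n%:R))//.
  apply/funext => n /=; congr (shannon _ / _); apply/funext => w.
  by rewrite atomE.
suff h_le0 : h <= 0 by rewrite (_ : 0 = h)//; apply/eqP; rewrite eq_le h0.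
have : (partition_entropy T nu P <= 0)%E; last by rewrite hE lee_fin.
rewrite -ks0; apply: ereal_sup_ubound; exists k, P; split=> //.
split=> [|i]; last by have [] := qj i.
split=> [|i j _ _ [y [/= <- <-]]|i _]//.
- by apply/seteqP; split => // y _; exists (q y).
- by have [y qy] := qs i; exists y.
Qed.

End deterministic_words.

(** * Riesz products and the deviation bound *)

Section riesz_product.
Context {R : realType} (U : set_system nat).
Hypotheses (U_ultra : UltraFilter U) (U_oo : \oo `<=` U).
Variable z : nat -> R.
Hypothesis z_le1 : forall n, `|z n| <= 1.
Hypothesis z_uncorrelated : forall m (A : {set 'I_m}), A != finset.set0 ->
  mean U (fun n => \prod_(h in A) z (h + n)%N) = 0.

Let bounded_z h : bounded_seq (fun n => z (h + n)%N).
Proof. by exists 1 => n. Qed.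

Let bounded_riesz m (c : 'I_m -> R) :
  bounded_seq (fun n => \prod_h (1 + c h * z (h + n)%N)).
Proof.
apply: bounded_seq_prod => h; apply: bounded_seqD; first exact: bounded_seq_cst.
exact: bounded_seqZ.
Qed.

(** Expanding over subsets of indices, only the empty one has a nonzero mean. *)
Lemma mean_riesz_product m (c : 'I_m -> R) :
  mean U (fun n => \prod_h (1 + c h * z (h + n)%N)) = 1.
Proof.
rewrite (_ : (fun n => _) = (fun n => \sum_(A : {set 'I_m})
    \prod_h (if h \in A then c h * z (h + n)%N else 1))); last first.
  apply/funext => n; under eq_bigr do rewrite addrC.
  rewrite [LHS](@bigA_distr R 0 1 *%R +%R _ (fun h => c h * z (h + n)%N) (fun=> 1)).
  by apply: eq_bigl => A; rewrite inE.
rewrite mean_sum//; last first.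
  move=> A; apply: bounded_seq_prod => h; case: (h \in A).
    exact: bounded_seqZ.
  exact: bounded_seq_cst.
rewrite (bigD1 finset.set0)//= big1 ?addr0 => [|A A0].
  rewrite -[RHS](mean_cst U_ultra); congr mean; apply/funext => n.
  by rewrite big1// => h _; rewrite inE.
rewrite (_ : (fun n => _) = (fun n => (\prod_(h in A) c h) * \prod_(h in A) z (h + n)%N)).
  by rewrite meanZ ?z_uncorrelated ?mulr0//; exact: bounded_seq_prod.
by apply/funext => n; rewrite -big_mkcond big_split.
Qed.

(** With y = t - 2t^2, exp y <= 1/(1 - y), and (1 + t)(1 - y) - 1 = t^2 (1 + 2t) >= 0. *)
Lemma expR_le1D (t : R) : - 2^-1 <= t -> expR (t - 2 * t ^+ 2) <= 1 + t.
Proof.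
move=> t2; have y1 : 0 < 1 - (t - 2 * t ^+ 2).
  have := sqr_ge0 (2 * t - 2^-1); rewrite expr2; lra.
have := expR_ge1Dx (- (t - 2 * t ^+ 2)).
rewrite expRN -[X in _ <= X -> _]mul1r ler_pdivlMr ?expR_gt0// => h.
rewrite -(ler_pM2l y1) (le_trans h)// -subr_ge0.
rewrite (_ : _ - _ = t ^+ 2 * (1 + 2 * t)); last by rewrite expr2; ring.
by rewrite mulr_ge0 ?sqr_ge0//; lra.
Qed.

(* Exponential Markov inequality with the Riesz product, of mean [1], in place
   of the exponential. *)
Lemma mean_deviation m (a : 'I_m -> R) (C delta : R) :
  0 < delta -> delta <= 2 * C -> (forall h, `|a h| <= C) ->
  mean U (fun n => (delta * m%:R <= \sum_h a h * z (h + n)%N)%R%:R) <=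
  expR (- (delta ^+ 2 / (8 * C ^+ 2)) * m%:R).
Proof.
move=> d0 dC aC; have C0 : 0 < C by lra.
(* This [l] maximizes l delta - 2 l^2 C^2, with maximum delta^2 / (8 C^2); delta <= 2C keeps l C <=
   1/2, as [expR_le1D] requires. *)
set E := expR _; pose l := delta / (4 * C ^+ 2).
have l0 : 0 < l by rewrite divr_gt0// mulr_gt0// exprn_gt0.
have lC : l * C <= 2^-1.
  rewrite (_ : l * C = delta / (4 * C)); last by rewrite /l; field; lra.
  by rewrite ler_pdivrMr ?mulr_gt0//; lra.
have azC h n : `|l * a h * z (h + n)%N| <= l * C.
  rewrite -mulrA normrM gtr0_norm// ler_wpM2l ?(ltW l0)//.
  by rewrite normrM -[leRHS]mulr1 ler_pM.
rewrite -[leRHS]mulr1 -[X in _ <= _ * X](mean_riesz_product (fun h => l * a h)) -meanZ//.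
apply: le_mean => //.
- exact: (@bounded_seq_bool R (fun n => delta * m%:R <= \sum_h a h * z (h + n)%N)).
- exact: bounded_seqZ.
move=> n; have P0 : 0 <= \prod_h (1 + l * a h * z (h + n)%N).
  apply: prodr_ge0 => h _; have := azC h n; rewrite ler_norml; lra.
case: (boolP (delta * m%:R <= \sum_h a h * z (h + n)%N)) => [dS|_];
  last by rewrite mulr0n mulr_ge0// expR_ge0.
rewrite mulr1n -[leLHS](expRxMexpNx_1 (- (delta ^+ 2 / (8 * C ^+ 2)) * m%:R)).
rewrite ler_wpM2l ?expR_ge0//.
apply: (@le_trans _ _ (\prod_h expR (l * a h * z (h + n)%N - 2 * (l * C) ^+ 2))); last first.
  apply: ler_prod => h _; rewrite expR_ge0/=.
  apply: le_trans (expR_le1D _); last by have := azC h n; rewrite ler_norml; lra.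
  rewrite ler_expR lerB// ler_wpM2l//.
  by rewrite -real_normK ?num_real// ler_pXn2r ?nnegrE// mulr_ge0 ?ltW.
rewrite -expR_sum ler_expR sumrB sumr_const card_ord -[X in _ <= _ - X]mulr_natr.
under [X in _ <= X - _]eq_bigr do rewrite -mulrA.
rewrite -mulr_sumr -subr_ge0.
apply: (@le_trans _ _ (l * (delta * m%:R) - 2 * (l * C) ^+ 2 * m%:R +
    - (delta ^+ 2 / (8 * C ^+ 2)) * m%:R)).
  rewrite (_ : _ + _ = 0)// /l; field. lra.
by rewrite opprK !lerD2r ler_wpM2l// ltW.
Qed.

Lemma expR_decay (c e : R) : 0 < c -> 0 < e ->
  \forall n \near \oo, expR (- (c * n%:R)) <= e.
Proof.
move=> c0 e0; exists (Num.truncn (e^-1 / c)).+1 => // n /= tn.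
rewrite expRN invf_ple ?posrE ?expR_gt0//.
apply: le_trans (expR_ge1Dx _); rewrite -[leLHS]add0r lerD// mulrC -ler_pdivrMr//.
by rewrite (le_trans (ltW (truncnS_gt _)))// ler_nat.
Qed.

(** The mean is also that of averages over blocks of length [m]. On a block, [phi] is within [eta]
    of a function of the word, so the block sum is close to a linear form in [z] fixed by that word.
    Bad blocks are those with an atypical word or a large deviation for some typical word. *)
Lemma mean_mul_deterministic k (v : nat -> 'I_k) (a : 'I_k -> R)
    (phi : nat -> R) (C eta delta : R) :
  (forall n, `|phi n| <= C) -> (forall i, `|a i| <= C) ->
  (forall n, `|phi n - a (v n)| <= eta) -> 0 < C -> 0 < delta ->
  (fun n => word_entropy U v n / n%:R) @ \oo --> (0 : R) ->
  `|mean U (fun n => phi n * z n)| <= eta + delta.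
Proof.
move=> phiC aC phia C0 delta0 v0.
(* The cap 2C is the range of validity of [mean_deviation]. *)
pose d := Num.min (delta / 2) (2 * C).
have d0 : 0 < d by rewrite lt_min divr_gt0//= mulr_gt0.
have dC : d <= 2 * C by rewrite ge_min lexx orbT.
have ddelta : d <= delta / 2 by rewrite ge_min lexx.
pose kappa := d ^+ 2 / (8 * C ^+ 2).
have kappa0 : 0 < kappa by rewrite divr_gt0// ?mulr_gt0// exprn_gt0.
(* Chosen so that the bad blocks, of mean at most 3 eps, cost at most C (3 eps) = delta / 2. *)
pose eps := delta / (6 * C).
have eps0 : 0 < eps by rewrite divr_gt0// mulr_gt0.
near \oo => m.
have m0 : (0 < m)%N by near: m; exists 1%N.
have mR : 0 < m%:R :> R by rewrite ltr0n.
have small : expR (- (kappa / 2 * m%:R)) <= eps.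
  by near: m; apply: expR_decay => //; rewrite divr_gt0.
have [W [cardW meanW]] : exists W : {set {ffun 'I_m -> 'I_k}},
    #|W|%:R <= expR (kappa / 2 * m%:R) /\
    mean U (fun t => (word v m t \notin W)%:R) <= eps.
  by near: m; apply: typical_words => //; rewrite divr_gt0.
pose S (w : {ffun 'I_m -> 'I_k}) n := \sum_h a (w h) * z (h + n)%N.
pose dev (w : {ffun 'I_m -> 'I_k}) n : R :=
  (d * m%:R <= S w n)%R%:R + (d * m%:R <= - S w n)%R%:R.
have bdev w : bounded_seq (dev w).
  apply: bounded_seqD.
    exact: (@bounded_seq_bool R (fun n => d * m%:R <= S w n)).
  exact: (@bounded_seq_bool R (fun n => d * m%:R <= - S w n)).
have mdev w : mean U (dev w) <= 2 * expR (- kappa * m%:R).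
  rewrite meanD//; last 2 first.
  - exact: (@bounded_seq_bool R (fun n => d * m%:R <= S w n)).
  - exact: (@bounded_seq_bool R (fun n => d * m%:R <= - S w n)).
  rewrite mulr2n mulrDl mul1r lerD//.
    exact: mean_deviation.
  rewrite (_ : (fun n => _) = fun n =>
      (d * m%:R <= \sum_h (- a (w h)) * z (h + n)%N)%R%:R).
    by apply: mean_deviation => // h; rewrite normrN.
  apply/funext => n; congr ((_ <= _)%R%:R); rewrite /S -sumrN.
  by apply: eq_bigr => h _; rewrite mulNr.
pose g n := phi n * z n.
have gC n : `|g n| <= C by rewrite normrM -[leRHS]mulr1 ler_pM.
have bg : bounded_seq g by exists C.
pose G n := m%:R^-1 * \sum_(h < m) g (h + n)%N.
have bgs h : bounded_seq (fun n => g (h + n)%N) by exists C => n.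
have bG : bounded_seq G by apply: bounded_seqZ; exact: bounded_seq_sum.
have -> : mean U (fun n => phi n * z n) = mean U G.
  rewrite meanZ; last exact: bounded_seq_sum.
  rewrite mean_sum//.
  rewrite (eq_bigr (fun=> mean U g)) => [|h _].
    by rewrite sumr_const card_ord -[X in _ * X]mulr_natl mulKf ?gt_eqF.
  rewrite -[RHS](mean_shift U_ultra U_oo h)//; congr mean.
  by apply/funext => n; rewrite addnC.
rewrite (le_trans (mean_norm_le U_ultra bG))//.
(* The bracket is at least 1 on bad blocks, where the trivial bound [C] suffices; elsewhere eta + d
   bounds the block average. *)
pose B n := eta + d + C * ((word v m n \notin W)%:R + \sum_(w in W) dev w n).
have bsum : bounded_seq (fun n => \sum_(w in W) dev w n) by exact: bounded_seq_sum.
have bW : bounded_seq (fun n => (word v m n \notin W)%:R : R) by exact: bounded_seq_bool.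
have bB : bounded_seq B.
  apply: bounded_seqD; first exact: bounded_seq_cst.
  by apply: bounded_seqZ; exact: bounded_seqD.
apply: (@le_trans _ _ (mean U B)).
  apply: le_mean => //; first exact: bounded_seq_norm.
  move=> n.
  have eta0 : 0 <= eta by exact: le_trans (phia n).
  have dev0 w : 0 <= dev w n by rewrite addr_ge0.
  have sdev0 : 0 <= \sum_(w in W) dev w n by exact: sumr_ge0.
  have Gle c : `|\sum_(h < m) g (h + n)%N| <= c * m%:R -> `|G n| <= c.
    by rewrite /G normrM ger0_norm ?invr_ge0// ler_pdivrMl// mulrC.
  have GC : `|G n| <= C.
    apply: Gle; rewrite (le_trans (ler_norm_sum _ _ _))//.
    apply: (@le_trans _ _ (\sum_(h < m) C)); first exact: ler_sum.
    by rewrite sumr_const card_ord -[leLHS]mulr_natr.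
  have CB : 1 <= (word v m n \notin W)%:R + \sum_(w in W) dev w n -> `|G n| <= B n.
    move=> big; rewrite (le_trans GC)// /B -[leLHS]add0r lerD//.
      by rewrite addr_ge0// ltW.
    by rewrite -[leLHS]mulr1 ler_wpM2l// ltW.
  have [wW|wW] := boolP (word v m n \in W); last first.
    by apply: CB; rewrite wW lerDl.
  have [S1|S1] := boolP (d * m%:R <= S (word v m n) n).
    apply: CB; rewrite wW add0r (bigD1 (word v m n))//= /dev S1 -addrA lerDl.
    by rewrite addr_ge0// sumr_ge0.
  have [S2|S2] := boolP (d * m%:R <= - S (word v m n) n).
    apply: CB; rewrite wW add0r (bigD1 (word v m n))//= /dev S2 addrAC.
    by rewrite addrC lerDl addr_ge0// sumr_ge0.
  rewrite /B -[leLHS]addr0 lerD//; last by rewrite mulr_ge0 ?(ltW C0)// addr_ge0.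
  apply: Gle; rewrite (_ : \sum_(h < m) g (h + n)%N = S (word v m n) n +
      \sum_(h < m) (phi (h + n)%N - a (v (h + n)%N)) * z (h + n)%N); last first.
    rewrite /S -big_split; apply: eq_bigr => h _ /=.
    by rewrite ffunE /g mulrBl addrC subrK.
  rewrite (le_trans (ler_normD _ _))// addrC mulrDl lerD//.
    rewrite (le_trans (ler_norm_sum _ _ _))//.
    apply: (@le_trans _ _ (\sum_(h < m) eta)).
      by apply: ler_sum => h _; rewrite normrM -[leRHS]mulr1 ler_pM.
    by rewrite sumr_const card_ord -[leLHS]mulr_natr.
  by move: S1 S2; rewrite -!ltNge ler_norml; lra.
rewrite meanD ?mean_cst//; last 2 first.
- exact: bounded_seq_cst.
- by apply: bounded_seqZ; exact: bounded_seqD.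
rewrite meanZ; last exact: bounded_seqD.
rewrite meanD// mean_sum//.
(* Union bound: exp(kappa m / 2) words, each of cost 2 exp(-kappa m). *)
have : \sum_(w in W) mean U (dev w) <= 2 * eps.
  apply: (@le_trans _ _ (\sum_(w in W) 2 * expR (- kappa * m%:R))).
    by apply: ler_sum => w _; exact: mdev.
  rewrite sumr_const -[leLHS]mulr_natl mulrCA ler_wpM2l//.
  apply: (@le_trans _ _ (expR (kappa / 2 * m%:R) * expR (- kappa * m%:R))).
    by rewrite ler_wpM2r// expR_ge0.
  by rewrite -expRD (_ : _ + _ = - (kappa / 2 * m%:R))//; field.
move=> sumdev.
apply: (@le_trans _ _ (eta + d + C * (eps + 2 * eps))).
  by rewrite lerD2l ler_wpM2l ?(ltW C0)// lerD.
rewrite (_ : C * _ = delta / 2); last by rewrite /eps; field; lra.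
by rewrite -addrA lerD2l; lra.
Unshelve. all: by end_near. Qed.

End riesz_product.

(** * Conditions (Ch) and (S) *)

Section correlations.
Context {R : realType}.

Lemma cvg_cesaroE (g : nat -> R) (l : R) :
  (fun N => (\sum_(1 <= n < N.+1) g n) / N%:R) @ \oo --> l <->
  cesaro g @ \oo --> l.
Proof.
rewrite -cvg_shiftS/=; set c := fun n => _; rewrite (_ : c = cesaro g)//.
by apply/funext => N; rewrite /c /cesaro big_add1/= big_mkord.
Qed.

(** If convergence failed, some free ultrafilter would contain a set of [N] whose averages stay away
    from [l]. *)
Lemma cvg_cesaro_ultra (g : nat -> R) (l : R) : bounded_seq g ->
  (forall U : set_system nat, UltraFilter U -> \oo `<=` U -> mean U g = l) ->
  cesaro g @ \oo --> l.
Proof.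
move=> bg gl; apply/cvgrPdist_le => e e0; apply: contrapT => far.
pose F : set_system nat := within [set N | ~ (`|l - cesaro g N| <= e)] \oo.
have FF : ProperFilter F.
  apply: Build_ProperFilter_ex => A FA.
  apply: contrapT => nA; apply: far.
  apply: (@filterS _ \oo _ _ _ _ FA) => N /= farA.
  by apply: contrapT => /farA AN; apply: nA; exists N.
have [U [U_ultra FU]] := ultraFilterLemma FF.
have ooU : \oo `<=` U by move=> A oA; apply: FU; apply: (@filterS _ \oo _ A) => // N AN _.
have Ufar : U [set N | ~ (`|l - cesaro g N| <= e)].
  by apply: FU; exists 0%N.
have := cvg_mean U_ultra bg; rewrite (gl U U_ultra ooU).
move=> /cvgrPdist_le/(_ e e0) Uclose.
by have [N [/= ? ?]] := filter_ex (filterI Ufar Uclose).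
Qed.

Context {I : Type} (idx : nat -> I) (z : I -> int).
Hypotheses (z_ternary : ternary z) (z_Ch : condition_Ch R idx z).

Let zR n : R := (z (idx n))%:~R.

Lemma ternary_norm_le1 n : `|zR n| <= 1.
Proof.
have := z_ternary (idx n); rewrite !inE /zR => /or3P[] /eqP ->.
- by rewrite normrN normr1.
- by rewrite normr0.
- by rewrite normr1.
Qed.

Variable U : set_system nat.
Hypotheses (U_ultra : UltraFilter U) (U_oo : \oo `<=` U).

Let bounded_zR h : bounded_seq (fun n => zR (h + n)%N).
Proof. by exists 1 => n; exact: ternary_norm_le1. Qed.

(** Shifting by the least index [h0] turns the product into a correlation based at [n] with positive
    increasing gaps [a], to which (Ch) applies with all exponents 1. *)
Lemma mean_sorted_prod (h0 : nat) (s : seq nat) : path ltn h0 s ->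
  mean U (fun n => \prod_(h <- h0 :: s) zR (h + n)%N) = 0.
Proof.
move=> hs; pose a (i : 'I_(size s)) := (nth 0%N s i - h0)%N.
have h0_lt (i : 'I_(size s)) : (h0 < nth 0 s i)%N.
  by have /allP := order_path_min ltn_trans hs; apply; exact: mem_nth.
have h0a (i : 'I_(size s)) : (nth 0 s i = h0 + a i)%N by rewrite subnKC// ltnW.
pose g n := zR n * \prod_(i < size s) zR (n + a i)%N.
have -> : (fun n => \prod_(h <- h0 :: s) zR (h + n)%N) = (fun n => g (n + h0)%N).
  apply/funext => n; rewrite big_cons /g addnC; congr (_ * _).
  rewrite (big_nth 0%N) big_mkord; apply: eq_bigr => i _.
  by rewrite h0a; congr zR; lia.
rewrite mean_shift//; last first.
  apply: bounded_seqM; first exact: (bounded_zR 0).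
  apply: bounded_seq_prod => i.
  by have [C zC] := bounded_zR 0; exists C => n; exact: zC.
suff cvg_g : cesaro g @ \oo --> 0 by apply: meanE => V V0; exact: U_oo (cvg_g V V0).
apply/cvg_cesaroE.
have aS (i j : 'I_(size s)) : (i < j)%N -> (a i < a j)%N.
  move=> ij; apply: ltn_sub2r; first exact: h0_lt.
  by apply: (sorted_ltn_nth ltn_trans 0%N (path_sorted hs)) => //; exact: ltn_ord.
have a1 (i : 'I_(size s)) : (1 <= a i)%N by rewrite subn_gt0.
have nall2 : ~ (forall s : 'I_(size s).+1, 1%N = 2%N) by move=> /(_ ord0).
have := z_Ch (i := fun=> 1%N) a1 aS (fun=> isT) nall2.
set c := (X in X @ _ --> _) => cvg_c.
rewrite (_ : (fun N => _) = c)//; apply/funext => N; congr (_ / _).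
rewrite rmorph_sum; apply: eq_bigr => n _.
by rewrite expr1 rmorphM rmorph_prod; congr (_ * _).
Qed.


Lemma mean_set_prod m (A : {set 'I_m}) : A != finset.set0 ->
  mean U (fun n => \prod_(h in A) zR (h + n)%N) = 0.
Proof.
move=> /set0Pn[h hA].
have : sorted ltn [seq val j | j <- enum A].
  rewrite sorted_map /enum_mem -enumT; apply: sorted_filter.
    by move=> j1 j2 j3; exact: ltn_trans.
  by rewrite -sorted_map val_enum_ord iota_ltn_sorted.
have : h \in enum A by rewrite mem_enum.
have -> : (fun n => \prod_(h in A) zR (h + n)%N) =
    (fun n => \prod_(j <- [seq val j | j <- enum A]) zR (j + n)%N).
  by apply/funext => n; rewrite big_map big_enum.
case: (enum A) => // h0 s _ /= hs.
exact: mean_sorted_prod.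
Qed.

(** Half of [e] covers the quantization of [f], the other half the deviation estimate. *)
Lemma mean_deterministic_mul (X : pmetricType R) (T : X -> X) (f : X -> R) (x : X) :
  compact [set: X] -> continuous T -> continuous f ->
  completely_deterministic T x -> mean U (fun n => f (iter n T x) * zR n) = 0.
Proof.
move=> cX cT cf x_det.
have [C fC] := continuous_bounded cX cf.
have C0 : 0 <= C by exact: le_trans (fC x).
apply/eqP; rewrite -normr_le0; apply/ler_addgt0Pr => e e0; rewrite add0r.
have e20 : 0 < e / 2 by rewrite divr_gt0.
have [k [q [qs qj qf]]] := borel_jordan_quantization
  (orbit_density T x U_ultra) cf fC e20.
have /choice[y yq] := qs.
have -> : e = e / 2 + e / 2 by rewrite -splitr.
(* C + 1 replaces C to have a strictly positive bound. *)
apply: (@mean_mul_deterministic R U U_ultra U_oo zR ternary_norm_le1 mean_set_prod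
  k (fun t => q (iter t T x)) (fun i => f (y i)) _ (C + 1)) => //.
- by move=> n; rewrite (le_trans (fC _))// lerDl.
- by move=> i; rewrite (le_trans (fC _))// lerDl.
- by move=> n; apply: qf; rewrite yq.
- by rewrite ltr_wpDl.
- exact: word_entropy_deterministic.
Qed.

End correlations.

(** * From real to complex observables *)

Section complex_averages.
Context {R : realType}.

Lemma norm_Re_le (a : Cplx R) : `|complex.Re a|%:C%C <= `|a|.
Proof.
rewrite normc_def lecR -sqrtr_sqr ler_sqrt ?addr_ge0 ?sqr_ge0//.
by rewrite lerDl sqr_ge0.
Qed.

Lemma norm_Im_le (a : Cplx R) : `|complex.Im a|%:C%C <= `|a|.
Proof.
rewrite normc_def lecR -sqrtr_sqr ler_sqrt ?addr_ge0 ?sqr_ge0//.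
by rewrite lerDr sqr_ge0.
Qed.

Lemma norm_le_Re_Im (a : Cplx R) : `|a| <= (`|complex.Re a| + `|complex.Im a|)%:C%C.
Proof.
rewrite normc_def lecR -[leRHS]ger0_norm ?addr_ge0// -[leRHS]sqrtr_sqr ler_sqrt ?sqr_ge0//.
rewrite sqrrD !real_normK ?num_real// addrAC lerDl mulrn_wge0// mulr_ge0//.
Qed.

Lemma continuous_Re (X : topologicalType) (f : X -> Cplx R) :
  continuous f -> continuous (fun x => complex.Re (f x)).
Proof.
move=> cf x; apply/cvgrPdist_le => e e0.
have e0C : 0 < e%:C%C :> Cplx R by rewrite ltcR.
have /cvgrPdist_le/(_ _ e0C) := cf x; apply: filterS => y fxy.
rewrite -lecR (le_trans _ fxy)//; have := norm_Re_le (f x - f y).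
by case: (f x) => ? ?; case: (f y).
Qed.

Lemma continuous_Im (X : topologicalType) (f : X -> Cplx R) :
  continuous f -> continuous (fun x => complex.Im (f x)).
Proof.
move=> cf x; apply/cvgrPdist_le => e e0.
have e0C : 0 < e%:C%C :> Cplx R by rewrite ltcR.
have /cvgrPdist_le/(_ _ e0C) := cf x; apply: filterS => y fxy.
rewrite -lecR (le_trans _ fxy)//; have := norm_Im_le (f x - f y).
by case: (f x) => ? ?; case: (f y).
Qed.

Lemma cvg_complex0 (u : nat -> Cplx R) :
  (fun n => complex.Re (u n)) @ \oo --> (0 : R) ->
  (fun n => complex.Im (u n)) @ \oo --> (0 : R) ->
  u @ \oo --> (0 : Cplx R).
Proof.
move=> u1 u2; apply/cvgr0Pnorm_le => e e0.
(* In the order on complex numbers, a positive element is a positive real. *)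
have [r r0 er] : exists2 r : R, 0 < r & e = r%:C%C.
  by case: e e0 => r i; rewrite ltcE/= => /andP[/eqP -> r0]; exists r.
have r20 : 0 < r / 2 by rewrite divr_gt0.
move/cvgr0Pnorm_le/(_ _ r20) : u1 => u1; move/cvgr0Pnorm_le/(_ _ r20) : u2 => u2.
near=> n; rewrite (le_trans (norm_le_Re_Im _))// er lecR (splitr r) lerD//.
  by near: n.
by near: n.
Unshelve. all: by end_near. Qed.

End complex_averages.

(** Both conditions see [z] only through the sequence [z (idx n)], so one argument serves both index
    sets; the real and imaginary parts of [f] are treated separately. *)
Lemma condition_Ch_S (R : realType) (I : Type) (idx : nat -> I) (z : I -> int) :
  ternary z -> condition_Ch R idx z -> condition_S R idx z.
Proof.
move=> z_ternary z_Ch X T f x cX [cT _] cf x_det.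
have real_case (g : X -> R) : continuous g ->
    (fun N => (\sum_(1 <= n < N.+1) g (iter n T x) * (z (idx n))%:~R) / N%:R)
      @ \oo --> (0 : R).
  move=> cg; apply/cvg_cesaroE; apply: cvg_cesaro_ultra => [|U U_ultra U_oo].
    have [C gC] := continuous_bounded cX cg.
    apply: bounded_seqM; first by exists C.
    by exists 1 => n; exact: ternary_norm_le1 z_ternary n.
  exact: mean_deterministic_mul.
pose avg (g : X -> R) N : R :=
  (\sum_(1 <= n < N.+1) g (iter n T x) * (z (idx n))%:~R) / N%:R.
pose u (N : nat) : Cplx R :=
  (avg (fun y => complex.Re (f y)) N +i* avg (fun y => complex.Im (f y)) N)%C.
rewrite (_ : (fun N => _) = u).
  apply: cvg_complex0; apply: real_case.
    exact: continuous_Re.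
  exact: continuous_Im.
apply/funext => N; rewrite /u.
pose c : {rmorphism R -> R[i]} := real_complex R.
have -> (r s : R) : (r +i* s)%C = c r + 'i%C * c s by rewrite [LHS]complexE.
have avgE (g : X -> R) :
    c (avg g N) = (\sum_(1 <= n < N.+1) c (g (iter n T x)) * (z (idx n))%:~R) / N%:R.
  rewrite /avg rmorphM fmorphV rmorph_nat rmorph_sum; congr (_ / _).
  by apply: eq_bigr => n _; rewrite rmorphM rmorph_int.
rewrite !avgE mulrA -mulrDl; congr (_ / _).
rewrite mulr_sumr -big_split/=; apply: eq_bigr => n _; rewrite mulrA -mulrDl.
by congr (_ * _); exact: complexE.
Qed.

Theorem theorem4p10 (R : realType) :
  (forall z : Npos -> int,
     ternary z -> condition_Ch R Npos_idx z -> condition_S R Npos_idx z) /\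
  (forall z : int -> int,
     ternary z -> condition_Ch R Posz z -> condition_S R Posz z).
Proof. by split=> z; exact: condition_Ch_S. Qed.
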